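(* Let $X$ be a Banach space with $\mathrm{Sz}(X)=\omega$. Then there is a separable closed subspace $Y\subseteq X$ with $\mathsf{p}(Y)=\mathsf{p}(X)$.
   Context: For a Banach space $X$, $B_X$ denotes its closed unit ball. For a weak$^\ast$-compact set $K\subset X^\ast$ and $\varepsilon>0$, the $\varepsilon$-Szlenk derivation is $$\iota_\varepsilon K=\{x^\ast\in K:\ \mathrm{diam}(K\cap U)>\varepsilon\text{ for every }w^\ast\text{-open neighborhood }U\text{ of }x^\ast\},$$ with iterates $\iota^0_\varepsilon K=K$, $\iota_\varepsilon^{\alpha+1}K=\iota_\varepsilon(\iota_\varepsilon^\alpha K)$, and $\iota_\varepsilon^\alpha K=\bigcap_{\beta<\alpha}\iota_\varepsilon^\beta K$ for limit $\alpha$. $\mathrm{Sz}(X,\varepsilon)$ is the least ordinal $\alpha$ (if any) with $\iota_\varepsilon^\alpha B_{X^\ast}=\varnothing$, and $\mathrm{Sz}(X)=\sup_{\varepsilon>0}\mathrm{Sz}(X,\varepsilon)$. The condition $\mathrm{Sz}(X)\leq\omega$ is equivalent to $\mathrm{Sz}(X,\varepsilon)$ being finite for every $\varepsilon>0$; it passes to closed subspaces. For $\mathrm{Sz}(X)\le\omega$ the following finite limit, called the Szlenk power type of $X$, exists: $$\mathsf{p}(X)=\lim_{\varepsilon\to0+}\frac{\log\mathrm{Sz}(X,\varepsilon)}{|\log\varepsilon|}.$$ *)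

(* Defs.v *)
From HB Require Import structures.
From mathcomp Require Import all_boot all_order all_algebra.
From mathcomp Require Import all_classical all_reals all_analysis.
From mathcomp Require Import complex.

Set Implicit Arguments.
Unset Strict Implicit.
Unset Printing Implicit Defensive.

Import Order.TTheory GRing.Theory Num.Theory.
Import numFieldNormedType.Exports.

Local Open Scope classical_set_scope.
Local Open Scope ring_scope.

(** Ordinals as well-founded trees, an ordinal having many representations;
    two of them denote the same ordinal when [ole] holds in both directions.
    [OSup f] is the supremum of an arbitrary (possibly empty, not necessarily
    increasing) family; every limit ordinal is of this form. *)
Inductive ord : Type :=
| OZero : ord
| OSucc : ord -> ord
| OSup : forall I : Type, (I -> ord) -> ord.

(** The inner fixpoint is [fun b => a' < b]. *)
Fixpoint ole (a : ord) : ord -> Prop :=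
  match a with
  | OZero => fun _ => True
  | OSucc a' =>
      fix olt (b : ord) : Prop :=
        match b with
        | OZero => False
        | OSucc b' => ole a' b'
        | OSup _ g => exists j, olt (g j)
        end
  | OSup _ f => fun b => forall i, ole (f i) b
  end.

Definition ord_of_nat (n : nat) : ord := iter n OSucc OZero.

Definition omega : ord := OSup ord_of_nat.

(** Banach spaces are real or complex. As the norm of a module over [K] is
    [K]-valued, the embedding [e] of the reals into [K] is recorded too. *)
Variant scalar_field (R : realType) : forall K : numFieldType, (R -> K) -> Prop :=
| RealScalars : @scalar_field R R (fun r => r)
| ComplexScalars : @scalar_field R R[i] (real_complex R).

(** A linear subspace with the norm of the ambient space. *)
Section subspace.
Variables (K : numFieldType) (X : normedModType K) (S : submodClosed X).

Definition normed_subspace : Type := {x : X | x \in S}.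

HB.instance Definition _ := SubChoice.on normed_subspace.
HB.instance Definition _ := [SubChoice_isSubLmodule of normed_subspace by <:].

Definition normed_subspace_norm (x : normed_subspace) : K := `|val x|.

Fact normed_subspace_normD x y :
  normed_subspace_norm (x + y)
  <= normed_subspace_norm x + normed_subspace_norm y.
Proof. exact: ler_normD. Qed.

Fact normed_subspace_normZ (l : K) x :
  normed_subspace_norm (l *: x) = `|l| * normed_subspace_norm x.
Proof. exact: normrZ. Qed.

Fact normed_subspace_norm_eq0 x : normed_subspace_norm x = 0 -> x = 0.
Proof. by move=> /normr0_eq0 x0; apply: val_inj. Qed.

HB.instance Definition _ := Lmodule_isNormed.Build K normed_subspace
  normed_subspace_normD normed_subspace_normZ normed_subspace_norm_eq0.

End subspace.

Definition separable (T : topologicalType) : Prop :=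
  exists D : set T, countable D /\ dense D.

(** Functionals are plain functions [X -> K], so that the weak* topology on the
    dual is the trace of the topology of pointwise convergence. *)
Section szlenk.
Variables (R : realType) (K : numFieldType) (e : R -> K) (X : normedModType K).
Implicit Types (f g : X -> K) (A : set (X -> K)) (eps : R).

Definition dual_norm f : \bar R :=
  ereal_sup [set r%:E | r in [set r : R |
    exists x : X, `|x| <= 1 /\ e r = `|f x| ]].

Definition dual_unit_ball : set (X -> K) :=
  [set f | scalar f /\ (dual_norm f <= 1)%E].

Definition dual_diam A : \bar R :=
  ereal_sup [set dual_norm (f \- g) | f in A & g in A].

Definition szlenk_derivation eps A : set (X -> K) :=
  [set f | A f /\ forall U : set {ptws X -> K},
     open U -> U f -> (eps%:E < dual_diam (A `&` U))%E].

(** At [OSup f] the conjunct [A g] only matters for the empty family, whose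
    supremum is zero. If [OSup f] is not a limit, it is zero or the largest
    [f i], and the clause is still right since the iterates decrease. *)
Fixpoint szlenk_iter eps A (a : ord) : set (X -> K) :=
  match a with
  | OZero => A
  | OSucc b => szlenk_derivation eps (szlenk_iter eps A b)
  | OSup _ f => [set g | A g /\ forall i, szlenk_iter eps A (f i) g]
  end.

(** [Sz(X, eps) = a] *)
Definition is_szlenk_at eps (a : ord) : Prop :=
  szlenk_iter eps dual_unit_ball a = set0 /\
  forall b, szlenk_iter eps dual_unit_ball b = set0 -> ole a b.

(** [Sz(X) = a] *)
Definition is_szlenk (a : ord) : Prop :=
  [/\ forall eps, 0 < eps -> exists b, is_szlenk_at eps b,
      forall eps b, 0 < eps -> is_szlenk_at eps b -> ole b a
    & forall c, (forall eps b, 0 < eps -> is_szlenk_at eps b -> ole b c) ->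
        ole a c].

(** [Sz(X, eps)] as a natural number, and [0] when it is not finite. *)
Definition szlenk_nat eps : nat :=
  xget 0%N [set n | is_szlenk_at eps (ord_of_nat n)].

(** [Sz(X) <= omega], and the limit defining [p(X)] exists and equals [p]. *)
Definition is_szlenk_power_type (p : R) : Prop :=
  (exists2 a, is_szlenk a & ole a omega) /\
  (fun eps => ln (szlenk_nat eps)%:R / `|ln eps|) @ 0^'+ --> p.

End szlenk.

(* Main.v *)
(** Every point of an iterate of the derivation of the dual ball of [X] has, in
    each of its weak* neighborhoods, a point of the previous iterate at distance
    more than [eps / 2], and a vector of the unit ball sees this distance.
    Closing off under countably many such choices (rational [eps], rational
    weak* neighborhoods given by vectors already chosen, rational linear
    combinations) gives a countable set of vectors whose closure is [Y]. The
    restrictions to [Y] of the chosen functionals lie in the iterates for [Y],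
    so that [Sz(X, eps) <= Sz(Y, eps / 4)]. Conversely, by Hahn-Banach and weak*
    compactness, [Sz(Y, eps) <= Sz(X, eps / 2)]. Since [Sz(X, .)] and [Sz(Y, .)]
    are submultiplicative, Fekete's argument gives the limit defining the power
    type; moreover they are within a constant factor of each other, whence the
    limits agree. *)

Require Import Defs.
From HB Require Import structures.
From mathcomp Require Import all_boot all_order all_algebra.
From mathcomp Require Import all_classical all_reals all_analysis.
From mathcomp Require Import complex.
From mathcomp Require Import ring lra.

Import Order.TTheory GRing.Theory Num.Theory.
Import numFieldNormedType.Exports.

Local Open Scope classical_set_scope.
Local Open Scope ring_scope.

Set Implicit Arguments.
Unset Strict Implicit.
Unset Printing Implicit Defensive.

(** * Comparison of ordinals represented by trees *)

Lemma ole_sup (a : ord) (I : Type) (f : I -> ord) (i : I) :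
  ole a (f i) -> ole a (OSup f).
Proof.
elim: a => [//|a _ afi|J g IHg /= gfi j]; first by exists i.
exact: IHg (gfi j).
Qed.

(** Totality is what makes a natural number that is least among the naturals least among all trees.
    The outer induction is on [b], along which [ole (OSucc a)] recurses. *)
Lemma ole_total (a b : ord) : ole (OSucc a) b \/ ole b a.
Proof.
elim: b a => [|b IHb|I g IHg] a; first by right.
- elim: a => [|a _|J f IHf]; [by left | exact: IHb | ].
  have [[j fj]|fb] := pselect (exists j, ole (OSucc b) (f j)).
    by right; exact: ole_sup fj.
  by left=> j; case: (IHf j) => // bf; case: fb; exists j.
- have [[j gj]|ga] := pselect (exists j, ole (OSucc a) (g j)).
    by left; exists j.
  by right=> j; case: (IHg j a) => // ag; case: ga; exists j.
Qed.

Lemma ole_nat (m n : nat) : ole (ord_of_nat m) (ord_of_nat n) <-> (m <= n)%N.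
Proof. by elim: m n => [|m IHm] [|n] //; exact: IHm. Qed.

(** The real part, with [j = 0] for real and [j = i] for complex scalars: the
    two cases can then be treated together. *)
Record scalar_parts (R : realType) (K : numFieldType) (e : R -> K)
    (re : K -> R) (j : K) : Prop := ScalarParts {
  sp_eD : forall a b, e (a + b) = e a + e b ;
  sp_eM : forall a b, e (a * b) = e a * e b ;
  sp_e1 : e 1 = 1 ;
  sp_le : forall a b, (e a <= e b) = (a <= b) ;
  sp_reD : forall k l, re (k + l) = re k + re l ;
  sp_reZ : forall r k, re (e r * k) = r * re k ;
  sp_reK : forall r, re (e r) = r ;
  sp_rej : forall r, re (j * e r) = 0 ;
  sp_real : forall k, k \is Num.real -> e (re k) = k ;
  sp_re_le : forall k, `|e (re k)| <= `|k| ;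
  sp_decomp : forall k, k = e (re k) - j * e (re (j * k)) ;
  sp_j : j = 0 \/ j * j = -1 }.

Lemma scalar_field_parts (R : realType) (K : numFieldType) (e : R -> K) :
  scalar_field e -> exists re j, scalar_parts e re j.
Proof.
case.
  exists id, 0; split => //=; first by move=> r; rewrite mul0r.
  - by move=> k; rewrite mul0r subr0.
  - by left.
exists (@complex.Re R), 'i%C; split => //=.
- by move=> a b; simpc.
- by move=> a b; simpc.
- by move=> a b; rewrite lecR.
- by move=> [a b] [c d].
- by move=> r [a b] /=; rewrite mul0r subr0.
- by move=> r; rewrite !mul0r mul1r subr0.
- by move=> [a b]; rewrite complex_real => /eqP /= ->.
- move=> [a b]; rewrite normc_def /= expr0n addr0 sqrtr_sqr.
  rewrite normc_def lecR /= -sqrtr_sqr ler_wsqrtr// lerDl; exact: sqr_ge0.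
- by move=> [a b]; simpc.
- by right; rewrite -expr2 sqr_i.
Qed.

(** * Hahn-Banach over the real or complex scalars *)

Section ScalarParts.
Context {R : realType} {K : numFieldType} {e : R -> K} {re : K -> R} {j : K}.
Hypothesis He : scalar_parts e re j.
Implicit Types (a b r : R) (k l : K).

Lemma sp_e0 : e 0 = 0.
Proof. by apply: (addrI (e 0)); rewrite -(sp_eD He) !addr0. Qed.

Lemma sp_eN a : e (- a) = - e a.
Proof. by apply: (addrI (e a)); rewrite -(sp_eD He) !subrr sp_e0. Qed.

Lemma sp_eB a b : e (a - b) = e a - e b.
Proof. by rewrite (sp_eD He) sp_eN. Qed.

Lemma sp_ge0 a : (0 <= e a) = (0 <= a).
Proof. by rewrite -sp_e0 (sp_le He). Qed.

Lemma sp_lt a b : (e a < e b) = (a < b).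
Proof. by rewrite !lt_leAnge !(sp_le He). Qed.

Lemma sp_gt0 a : (0 < e a) = (0 < a).
Proof. by rewrite -sp_e0 sp_lt. Qed.

Lemma sp_norm a : `|e a| = e `|a|.
Proof.
have [a0|a0] := leP 0 a; first by rewrite !ger0_norm ?sp_ge0.
by rewrite !ltr0_norm ?sp_eN// -sp_e0 sp_lt.
Qed.

Lemma sp_ge0E k : 0 <= k -> e (re k) = k.
Proof. by move=> k0; exact: (sp_real He (ger0_real k0)). Qed.

Lemma sp_normE (V : normedZmodType K) (x : V) : e (re `|x|) = `|x|.
Proof. exact: sp_ge0E. Qed.

Lemma sp_norm_ge0 (V : normedZmodType K) (x : V) : 0 <= re `|x|.
Proof. by rewrite -sp_ge0 sp_normE. Qed.

Lemma sp_re0 : re 0 = 0.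
Proof. by rewrite -sp_e0 (sp_reK He). Qed.

Lemma sp_reN k : re (- k) = - re k.
Proof. by apply: (addrI (re k)); rewrite -(sp_reD He) !subrr sp_re0. Qed.

Lemma sp_normj_le1 : `|j| <= 1.
Proof.
case: (sp_j He) => [->|jj]; first by rewrite normr0.
have : `|j| ^+ 2 = 1 by rewrite -normrX expr2 jj normrN1.
by move/eqP; rewrite sqrp_eq1// => /eqP ->.
Qed.

Section HahnBanach.
Variable X : normedModType K.
Implicit Types (x y : X) (p q : X -> R).

Definition sublinear q :=
  (forall x y, q (x + y) <= q x + q y) /\
  (forall r x, 0 < r -> q (e r *: x) = r * q x).

Lemma sublinear0 q : sublinear q -> q 0 = 0.
Proof.
move=> [_ /(_ 2 0)]; rewrite scaler0 => /(_ (ltr0Sn _ _)) q0.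
by move: q0; lra.
Qed.

Lemma sublinear_ge0 q r x : sublinear q -> 0 <= r -> q (e r *: x) = r * q x.
Proof.
move=> sq; rewrite le0r => /orP[/eqP ->|]; last exact: sq.2.
by rewrite sp_e0 scale0r mul0r sublinear0.
Qed.

Lemma sublinear_opp q x : sublinear q -> - q (- x) <= q x.
Proof. by move=> sq; have := sq.1 x (- x); rewrite subrr sublinear0//; lra. Qed.

Lemma sublinear_norm : sublinear (fun x => re `|x|).
Proof.
split=> [x y|r x r0].
  by rewrite -(sp_le He) (sp_eD He) !sp_normE ler_normD.
by rewrite normrZ sp_norm gtr0_norm// (sp_reZ He).
Qed.

(** [q'] is the inf-convolution of [q] with the cone [G]. *)
Lemma sublinear_cone q (G : X -> R -> Prop) :
  sublinear q -> G 0 0 ->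
  (forall x s y t, G x s -> G y t -> G (x + y) (s + t)) ->
  (forall r x s, 0 < r -> G x s -> G (e r *: x) (r * s)) ->
  (forall x s, G x s -> 0 <= q (- x) + s) ->
  exists q', [/\ sublinear q', forall x, q' x <= q x
    & forall x s, G x s -> q' x <= s].
Proof.
move=> sq G0 GD GZ Gq.
pose E x := [set a | exists y s, G y s /\ a = q (x - y) + s].
have E0 x : E x !=set0 by exists (q (x - 0) + 0); exists 0, 0.
(* By subadditivity [q (- y) <= q (x - y) + q (- x)], while [Gq] gives [0 <= q (- y) + s]. *)
have Elb x : has_lbound (E x).
  exists (- q (- x)) => _ [y [s [Gys ->]]].
  have := Gq _ _ Gys; have := sq.1 (x - y) (- x).
  by rewrite addrAC subrr add0r; lra.
pose q' x := inf (E x).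
have q'E x y s : G y s -> q' x <= q (x - y) + s.
  by move=> Gys; apply: ge_inf => //; exists y, s.
have q'le x c : (forall y s, G y s -> c <= q (x - y) + s) -> c <= q' x.
  by move=> cl; apply: lb_le_inf => // _ [y [s [Gys ->]]]; exact: cl.
have q'Z r x : 0 < r -> r * q' x <= q' (e r *: x).
  move=> r0; apply: (q'le _ _) => y s Gys.
  have r0' : 0 < r^-1 by rewrite invr_gt0.
  have er0 : e r != 0 by rewrite lt0r_neq0// sp_gt0.
  rewrite -ler_pdivlMl//; apply: le_trans (q'E _ _ _ (GZ _ _ _ r0' Gys)) _.
  rewrite mulrDr lerD2r -(sq.2 _ _ r0') scalerBr scalerA -(sp_eM He).
  by rewrite mulVf ?gt_eqF// (sp_e1 He) scale1r.
exists q'; split; last first.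
- move=> x s Gxs; apply: le_trans (q'E _ _ _ Gxs) _.
  by rewrite subrr sublinear0// add0r.
- by move=> x; apply: le_trans (q'E _ _ _ G0) _; rewrite subr0 addr0.
split=> [x y|r x r0].
- rewrite -lerBlDr; apply: (q'le _ _) => z s Gzs.
  rewrite lerBlDr -lerBlDl; apply: (q'le _ _) => w t Gwt.
  rewrite lerBlDl; apply: le_trans (q'E _ _ _ (GD _ _ _ _ Gzs Gwt)) _.
  have := sq.1 (x - z) (y - w); rewrite opprD addrACA; lra.
(* The other inequality is [q'Z] for [r^-1] at [e r *: x]. *)
- apply/eqP; rewrite eq_le q'Z// andbT.
  have r0' : 0 < r^-1 by rewrite invr_gt0.
  have := q'Z _ (e r *: x) r0'.
  rewrite scalerA -(sp_eM He) mulVf ?gt_eqF// (sp_e1 He) scale1r.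
  by rewrite ler_pdivrMl.
Qed.

(** Zorn's lemma for the reversed pointwise order. A nonempty chain is bounded by its pointwise
    infimum, which is finite because every member is at least [- p (- x)] at [x]. *)
Lemma sublinear_minimal p : sublinear p ->
  exists q, [/\ sublinear q, forall x, q x <= p x &
    forall q', sublinear q' -> (forall x, q' x <= q x) -> q' = q].
Proof.
move=> sp.
pose T := {q | sublinear q /\ forall x, q x <= p x}.
pose Rel (s t : T) := `[< forall x, projT1 t x <= projT1 s x >].
have := @Zorn T Rel; case.
- by move=> s; apply/asboolP.
- move=> s t u /asboolP st /asboolP tu; apply/asboolP => x.
  exact: le_trans (tu x) (st x).
- move=> [s Hs] [t Ht] /asboolP st /asboolP ts.
  by apply: eq_exist; apply/funext => x; apply/eqP; rewrite eq_le ts st.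
- move=> A Atot.
  have [[s0 As0]|A0] := pselect (exists s, A s); last first.
    exists (exist _ p (conj sp (fun x => lexx (p x)))) => s As.
    by case: A0; exists s.
  pose E x := [set projT1 s x | s in A].
  have E0 x : E x !=set0 by exists (projT1 s0 x); exists s0.
  have Elb x : has_lbound (E x).
    exists (- p (- x)) => _ [s As <-].
    have := sublinear_opp x (projT2 s).1.
    by have := (projT2 s).2 (- x); lra.
  pose m x := inf (E x).
  have mE x s : A s -> m x <= projT1 s x.
    by move=> As; apply: ge_inf => //; exists s.
  have mle x c : (forall s, A s -> c <= projT1 s x) -> c <= m x.
    by move=> cl; apply: lb_le_inf => // _ [s As <-]; exact: cl.
  have sm : sublinear m.
    split=> [x y|r x r0].
    - rewrite -lerBlDr; apply: (mle _ _) => s As.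
      rewrite lerBlDr -lerBlDl; apply: (mle _ _) => t At; rewrite lerBlDl.
      (* In a chain, the smaller of [s] and [t] serves for both summands. *)
      have [/asboolP st|/asboolP ts] := Atot _ _ As At.
        apply: le_trans (mE _ _ At) _; apply: le_trans ((projT2 t).1.1 _ _) _.
        by rewrite lerD2r.
      apply: le_trans (mE _ _ As) _; apply: le_trans ((projT2 s).1.1 _ _) _.
      by rewrite lerD2l.
    - apply/eqP; rewrite eq_le; apply/andP; split.
        rewrite -ler_pdivrMl//; apply: (mle _ _) => s As.
        by rewrite ler_pdivrMl// -((projT2 s).1.2 _ _ r0); exact: mE.
      apply: (mle _ _) => s As; rewrite ((projT2 s).1.2 _ _ r0).
      by rewrite ler_pM2l//; exact: mE.
  have mp x : m x <= p x.
    by apply: le_trans (mE _ _ As0) _; exact: (projT2 s0).2.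
  exists (exist _ m (conj sm mp)) => s As; apply/asboolP => x /=.
  exact: mE.
move=> [q [sq qp]] qmin; exists q; split=> // q' sq' q'q.
have q'p x : q' x <= p x by exact: le_trans (q'q x) (qp x).
have qq' : Rel (exist _ q (conj sq qp)) (exist _ q' (conj sq' q'p)).
  exact/asboolP.
by have [] := qmin _ qq'.
Qed.

(** A minimal sublinear functional [q] is odd, hence linear: convolving it with
    the ray spanned by [(- x, - q x)] cannot decrease it. *)
Lemma sublinear_linear p : sublinear p ->
  exists g, [/\ forall x, g x <= p x, forall x y, g (x + y) = g x + g y
    & forall r x, g (e r *: x) = r * g x].
Proof.
move=> /sublinear_minimal[q [sq qp qmin]].
have qN x : q (- x) = - q x.
  apply/eqP; rewrite eq_le; apply/andP; split; last first.
    by have := sublinear_opp x sq; lra.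
  pose G y s := exists2 t, 0 <= t & y = - (e t *: x) /\ s = - (t * q x).
  have [] := @sublinear_cone q G sq.
  - by exists 0; rewrite // sp_e0 scale0r mul0r !oppr0.
  - move=> y s z t [a a0 [-> ->]] [b b0 [-> ->]].
    by exists (a + b); rewrite ?addr_ge0// (sp_eD He) scalerDl mulrDl !opprD.
  - move=> r y s r0 [a a0 [-> ->]]; exists (r * a).
      by rewrite mulr_ge0// ltW.
    by rewrite scalerN scalerA (sp_eM He) mulrN mulrA.
  - by move=> y s [a a0 [-> ->]]; rewrite opprK sublinear_ge0// subrr.
  move=> q' [sq' q'q q'G]; have <- := qmin _ sq' q'q.
  have := q'G (- x) (- q x); rewrite (qmin _ sq' q'q); apply.
  by exists 1; rewrite // (sp_e1 He) scale1r mul1r.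
have qD x y : q (x + y) = q x + q y.
  apply/eqP; rewrite eq_le sq.1 /=; have := sq.1 (- x) (- y).
  by rewrite -opprD !qN; lra.
exists q; split=> // r x; have [r0|r0] := leP 0 r.
  by rewrite sublinear_ge0.
rewrite -[r]opprK sp_eN scaleNr qN sublinear_ge0// ?mulNr// ?oppr_ge0//.
exact: ltW.
Qed.

(** The norm is convolved with the graph of the real part of [f]. A real-linear functional below the
    result is at most [re (f u)] on the subspace, and oddness turns this into equality. *)
Lemma hahn_banach (S : submodClosed X) (f : normed_subspace S -> K) :
  scalar f -> (forall u, `|f u| <= `|u|) ->
  exists F : X -> K, [/\ scalar F, forall x, `|F x| <= `|x|
    & forall u, F (val u) = f u].
Proof.
move=> sf fle.
have fD u v : f (u + v) = f u + f v by have := sf 1 u v; rewrite scale1r mul1r.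
have f0 : f 0 = 0 by apply: (addrI (f 0)); rewrite -fD !addr0.
have fZ k u : f (k *: u) = k * f u by have := sf k u 0; rewrite f0 !addr0.
have fN u : f (- u) = - f u by apply: (addrI (f u)); rewrite -fD !subrr.
pose G x s := exists2 y : normed_subspace S, x = val y & s = re (f y).
have [] := @sublinear_cone _ G sublinear_norm.
- by exists 0; rewrite ?raddf0// f0 sp_re0.
- move=> _ _ _ _ [y -> ->] [z -> ->]; exists (y + z); rewrite ?raddfD//.
  by rewrite fD (sp_reD He).
- move=> r _ _ _ [y -> ->]; exists (e r *: y); first by rewrite linearZ.
  by rewrite fZ (sp_reZ He).
- move=> _ _ [y -> ->]; rewrite normrN.
  have : `|re (f y)| <= re `|val y|.
    rewrite -(sp_le He) -sp_norm sp_normE; apply: le_trans (fle y).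
    exact: (sp_re_le He).
  by rewrite ler_norml => /andP[]; lra.
move=> q [sq qle qG]; have [g [gle gD gZ]] := sublinear_linear sq.
have g0 : g 0 = 0 by apply: (addrI (g 0)); rewrite -gD !addr0.
have gN x : g (- x) = - g x.
  by apply: (addrI (g x)); rewrite -gD !subrr.
have gf u : g (val u) = re (f u).
  have gl v : g (val v) <= re (f v).
    by apply: le_trans (gle _) _; apply: qG; exists v.
  apply/eqP; rewrite eq_le gl /=; have := gl (- u).
  by rewrite raddfN gN fN sp_reN; lra.
(* A complex functional is recovered from its real part as [g x - i g (i x)]; for real scalars [j]
   is zero and this is [g]. *)
pose F x := e (g x) - j * e (g (j *: x)).
have FD x y : F (x + y) = F x + F y.
  by rewrite /F scalerDr !gD !(sp_eD He); ring.
have Fe r x : F (e r *: x) = e r * F x.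
  have jr : j *: (e r *: x) = e r *: (j *: x) by rewrite !scalerA mulrC.
  by rewrite /F jr !gZ !(sp_eM He); ring.
have F0 : F 0 = 0 by apply: (addrI (F 0)); rewrite -FD !addr0.
have FN x : F (- x) = - F x by apply: (addrI (F x)); rewrite -FD !subrr.
have Fj x : F (j *: x) = j * F x.
  case: (sp_j He) => [->|jj]; first by rewrite scale0r F0 mul0r.
  by rewrite /F scalerA jj scaleN1r gN sp_eN mulrBr mulrA jj; ring.
have FZ k x : F (k *: x) = k * F x.
  have [a [b ->]] : exists a b, k = e a - j * e b.
    by exists (re k), (re (j * k)); exact: (sp_decomp He).
  by rewrite scalerBl -scalerA FD FN Fe Fj Fe; ring.
exists F; split.
- by move=> k x y; rewrite FD FZ.
- move=> x; have [->|Fx0] := eqVneq (F x) 0; first by rewrite normr0.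
  (* Multiplying [x] by the unimodular [l] makes the value of [F] a nonnegative real, hence equal to
     its real part [g (l *: x)]. *)
  pose l := `|F x| / F x.
  have l1 : `|l| = 1 by rewrite /l normrM normfV normr_id divff ?normr_eq0.
  have Fl : F (l *: x) = `|F x| by rewrite FZ /l divfK.
  have -> : `|F x| = e (g (l *: x)).
    rewrite -Fl -[LHS]sp_ge0E ?Fl// -Fl /F (sp_reD He) sp_reN (sp_reK He).
    by rewrite (sp_rej He) subr0.
  rewrite -[`|x|]mul1r -l1 -normrZ -sp_normE (sp_le He).
  exact: le_trans (gle _) (qle _).
- move=> y; have -> : F (val y) = e (re (f y)) - j * e (re (j * f y)).
    by rewrite /F gf -linearZ gf fZ.
  by rewrite -(sp_decomp He).
Qed.

End HahnBanach.
End ScalarParts.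

(** * The weak* topology *)

Section PointwiseTopology.
Context {K : numFieldType} {X : normedModType K}.
Implicit Types (f g : {ptws X -> K}) (U : set {ptws X -> K}).

Lemma ptws_evaluation x : continuous (fun f => f x).
Proof. exact: (@proj_continuous X (fun=> K) x). Qed.

(** The sets on the right generate a filter that converges pointwise to [f], so it contains every
    neighborhood. Conversely each of them is a finite intersection of preimages of balls under
    evaluations. *)
Lemma ptws_nbhsP f U : nbhs f U <->
  exists (s : seq X) (d : K), 0 < d /\
    forall g, (forall x, x \in s -> `|g x - f x| < d) -> U g.
Proof.
split.
- pose P (p : seq X * K) := [set g | forall x, x \in p.1 -> `|g x - f x| < p.2].
  pose F := filter_from [set p : seq X * K | 0 < p.2] P.
  have FF : Filter F.
    apply: filter_from_filter; first by exists ([::], 1) => /=.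
    move=> [s a] [t b] /= a0 b0.
    exists (s ++ t, Num.min a b) => /=.
      by rewrite /Num.min; case: ifP.
    (* [K] is only partially ordered, but positive scalars are real, hence comparable. *)
    have ab : a >=< b by apply: real_comparable; exact: gtr0_real.
    move=> g /= gst; split=> x xs /=.
      have := gst x; rewrite mem_cat xs => /(_ isT).
      by rewrite comparable_lt_min// => /andP[].
    have := gst x; rewrite mem_cat xs orbT => /(_ isT).
    by rewrite comparable_lt_min// => /andP[].
  have Ff : {ptws, F --> f}.
    apply/pointwise_cvgP => x; apply/cvgrPdist_lt => d d0.
    exists ([:: x], d) => //= g /(_ x); rewrite mem_head => /(_ isT).
    by rewrite distrC.
  move=> /Ff [[s d] /= d0 sub]; exists s, d; split=> // g gs; exact: sub.
- move=> [s [d [d0 sub]]].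
  pose W (t : seq X) : set {ptws X -> K} :=
    fun g => forall x, x \in t -> `|g x - f x| < d.
  suff Wn : nbhs f (W s) by exact: (@filterS _ _ (nbhs_filter f) _ _ sub Wn).
  elim: s {sub} => [|x s IHs].
    have W0 : [set: {ptws X -> K}] `<=` W [::] by [].
    exact: (@filterS _ _ (nbhs_filter f) _ _ W0 (@filterT _ _ (nbhs_filter f))).
  have xn : nbhs f ((fun g : {ptws X -> K} => g x) @^-1` ball (f x) d).
    by apply: (@ptws_evaluation x f); exact: nbhsx_ballx.
  apply: (@filterS _ _ (nbhs_filter f) _ _ _
    (@filterI _ _ (nbhs_filter f) _ _ xn IHs)) => g [gx gs] y.
  have [-> _|yx] := eqVneq y x; first by rewrite distrC; exact: gx.
  by rewrite in_cons (negbTE yx); exact: gs.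
Qed.

End PointwiseTopology.

(** * The dual unit ball and a single Szlenk derivation *)

Section Dual.
Context {R : realType} {K : numFieldType} {e : R -> K} {re : K -> R} {j : K}.
Hypothesis He : scalar_parts e re j.

Lemma sp_continuous : continuous e.
Proof.
move=> a; apply/cvgrPdist_lt => d d0.
have d0' : 0 < re d by rewrite -(sp_gt0 He) (sp_ge0E He)// ltW.
have := @nbhsx_ballx _ R a _ d0'; apply: filterS => b /= ab.
by rewrite -(sp_eB He) (sp_norm He) -[ltRHS](sp_ge0E He) ?(ltW d0)// (sp_lt He).
Qed.

(** Real and imaginary parts of such a scalar lie in [[- r, r]], so it belongs to the continuous
    image of a compact square. *)
Lemma norm_le_compact r : exists2 C : set K,
  compact C & forall k, `|k| <= e r -> C k.
Proof.
pose F (p : R * R) := e p.1 - j * e p.2.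
exists (F @` (`[- r, r]%classic `*` `[- r, r]%classic)).
  apply: continuous_compact; last first.
    by apply: compact_setX; exact: segment_compact.
  apply: continuous_subspaceT => p; apply: cvgB.
    by apply: (@cvg_comp _ _ _ fst e); [exact: cvg_fst|exact: sp_continuous].
  apply: cvgM; first exact: cvg_cst.
  by apply: (@cvg_comp _ _ _ snd e); [exact: cvg_snd|exact: sp_continuous].
have rele k : `|k| <= e r -> `[- r, r]%classic (re k).
  move=> kr; rewrite /= in_itv /= -ler_norml -(sp_le He) -(sp_norm He).
  exact: le_trans (sp_re_le He k) kr.
move=> k kr; exists (re k, re (j * k)); last exact/esym/(sp_decomp He).
split; apply: rele => //; rewrite normrM; apply: le_trans kr.
by rewrite ler_piMl// (sp_normj_le1 He).
Qed.

Variable X : normedModType K.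
Implicit Types (f g h : {ptws X -> K}) (A : set {ptws X -> K}).
Implicit Types (U : set {ptws X -> K}) (eps : R).

(** A strict lower bound on the supremum is witnessed by a vector, so that diameters can be handled
    by inequalities in [K]. *)
Lemma lt_dual_normP eps (f : X -> K) : (eps%:E < dual_norm e f)%E <->
  exists2 x, `|x| <= 1 & e eps < `|f x|.
Proof.
split.
  move=> /ereal_sup_gt[_ [r [x [x1 rx] <-]]]; rewrite lte_fin => er.
  by exists x => //; rewrite -rx (sp_lt He).
move=> [x x1 ex]; apply/ereal_sup_gtP; exists (re `|f x|)%:E.
  by exists (re `|f x|) => //; exists x; split => //; exact: (sp_normE He).
by rewrite lte_fin -(sp_lt He) (sp_normE He).
Qed.

Lemma dual_unit_ballP (f : X -> K) : dual_unit_ball e f <->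
  scalar f /\ forall x, `|f x| <= `|x|.
Proof.
split=> [[sf f1]|[sf f1]]; split => //; last first.
  rewrite leNgt; apply/negP => /lt_dual_normP[x x1].
  by rewrite (sp_e1 He) real_ltNge// (le_trans (f1 x)).
have fZ k x : f (k *: x) = k * f x.
  have f0 : f 0 = 0.
    have := sf 1 0 0; rewrite scale1r mul1r !addr0 => f00.
    by apply: (addrI (f 0)); rewrite -f00 addr0.
  by have := sf k x 0; rewrite f0 !addr0.
move=> x; have [->|x0] := eqVneq x 0.
  by have := fZ 0 0; rewrite scale0r mul0r => ->; rewrite !normr0.
have nx0 : 0 < `|x| by rewrite normr_gt0.
rewrite real_leNgt//; apply/negP => xf; move: f1; rewrite leNgt => /negP; apply.
apply/lt_dual_normP; exists (`|x|^-1 *: x).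
  by rewrite normrZ normfV normr_id mulVf ?gt_eqF.
by rewrite fZ normrM normfV normr_id (sp_e1 He) mulrC ltr_pdivlMr// mul1r.
Qed.

Lemma szlenk_derivationP eps A f : szlenk_derivation e eps A f <->
  A f /\ forall U, nbhs f U -> exists g h x,
    [/\ A g /\ U g, A h /\ U h, `|x| <= 1 & e eps < `|g x - h x|].
Proof.
split=> -[Af H]; split => // U.
  rewrite nbhsE => -[V [oV Vf] VU].
  have /ereal_sup_gt[_ [g [Ag Vg] [h [Ah Vh] <-]]] := H V oV Vf.
  move=> /lt_dual_normP[x x1 gh].
  by exists g, h, x; split => //; split => //; exact: VU.
move=> oU Uf; have [|g [h [x [Ag Ah x1 gh]]]] := H U.
  by apply: open_nbhs_nbhs.
apply/ereal_sup_gtP; exists (dual_norm e (g \- h)).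
  by exists g => //; exists h.
by apply/lt_dual_normP; exists x.
Qed.

(** At the vector separating [g] and [h], the triangle inequality keeps one of the two more than
    [eps / 2] away from [f]. *)
Lemma szlenk_derivation_half eps A f U : szlenk_derivation e eps A f ->
  nbhs f U ->
  exists g x, [/\ A g, U g, `|x| <= 1 & e (eps / 2) < `|g x - f x|].
Proof.
move=> /szlenk_derivationP[Af H] /H [g [h [x [[Ag Ug] [Ah Uh] x1 gh]]]].
have [gf|gf] := boolP (e (eps / 2) < `|g x - f x|); first by exists g, x.
exists h, x; split => //; rewrite real_ltNge ?(normr_real, realE)//; last first.
  by rewrite !(sp_ge0 He) -(sp_e0 He) !(sp_le He) le_total.
apply/negP => hf; move: gh; rewrite real_ltNge//; last first.
  by rewrite realE !(sp_ge0 He) -(sp_e0 He) !(sp_le He) le_total.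
move/negP; apply.
rewrite [eps]splitr (sp_eD He) -[g x](subrK (f x)) -addrA.
apply: le_trans (ler_normD _ _) _; apply: lerD; last by rewrite distrC.
rewrite real_leNgt// realE !(sp_ge0 He) -(sp_e0 He) !(sp_le He).
exact: le_total.
Qed.

Lemma szlenk_derivation_intro eps A f : A f ->
  (forall U, nbhs f U ->
    exists g x, [/\ A g, U g, `|x| <= 1 & e eps < `|g x - f x|]) ->
  szlenk_derivation e eps A f.
Proof.
move=> Af H; apply/szlenk_derivationP; split => // U Uf.
have [g [x [Ag Ug x1 gf]]] := H U Uf; exists g, f, x; split => //.
by split => //; exact: nbhs_singleton.
Qed.

(** An open set around a limit point [f] is also an open set around some point of the derivation, so
    its trace on [A] has large diameter. *)
Lemma closed_szlenk_derivation eps A :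
  closed A -> closed (szlenk_derivation e eps A : set {ptws X -> K}).
Proof.
move=> cA f clf.
have Af : A f.
  apply: cA => U /clf[g [/szlenk_derivationP[Ag _] Ug]]; by exists g.
split => // U oU Uf.
have [|g [[_ H] Ug]] := clf U; first exact: open_nbhs_nbhs.
exact: H.
Qed.

(** Banach-Alaoglu: the ball is pointwise closed in a product of compact sets, to which Tychonoff's
    theorem applies. *)
Lemma compact_dual_unit_ball :
  compact (@dual_unit_ball R K e X : set {ptws X -> K}).
Proof.
have H (x : X) : exists C : set K, compact C /\ forall k, `|k| <= `|x| -> C k.
  by have [C cC CP] := norm_le_compact (re `|x|); exists C; split => // k;
    rewrite -(sp_normE He x); exact: CP.
have [C CP] := choice H.
apply: (@subclosed_compact {ptws X -> K} _ (fun f => forall x, C x (f x))).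
- move=> f clf; apply/dual_unit_ballP; split.
    move=> k x y; apply/eqP; rewrite -subr_eq0; apply/eqP.
    suff : closed
        [set f : {ptws X -> K} | f (k *: x + y) - (k * f x + f y) = 0].
      apply => U /clf[g [/dual_unit_ballP[sg _] Ug]]; exists g; split => //=.
      by rewrite sg subrr.
    apply: (@closed_comp _ _
      (fun f : {ptws X -> K} => f (k *: x + y) - (k * f x + f y)) [set 0 : K]).
      move=> g _.
      have ev z : (fun f : {ptws X -> K} => f z) @ g --> (g z : K^o).
        exact: ptws_evaluation.
      apply: (@cvgB K K^o _ (nbhs g) _ (fun f : {ptws X -> K} => f (k *: x + y))
        (fun f : {ptws X -> K} => k * f x + f y) _ _ (ev _)).
      apply: (@cvgD K K^o _ (nbhs g) _ (fun f : {ptws X -> K} => k * f x)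
        (fun f : {ptws X -> K} => f y) _ _ _ (ev _)).
      exact: (@cvgMl_tmp K _ (nbhs g) _ (fun f : {ptws X -> K} => f x) k _
        (ev _)).
    apply: accessible_closed_set1; apply: hausdorff_accessible.
    exact: norm_hausdorff.
  move=> x; rewrite real_leNgt//; apply/negP => xf.
  have [|g [/dual_unit_ballP[_ g1] gf]] :=
      clf [set g | `|g x - f x| < `|f x| - `|x|].
    apply/ptws_nbhsP; exists [:: x], (`|f x| - `|x|).
    by rewrite subr_gt0; split => // g; apply; rewrite mem_head.
  move: gf => /=; rewrite real_ltNge// ?realB// => /negP; apply.
  rewrite lerBlDr -{1}(subKr (g x) (f x)); apply: le_trans (ler_normB _ _) _.
  by rewrite addrC lerD2l.
- by apply: (@tychonoff X (fun=> K)) => x; have [] := CP x.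
- by move=> f /dual_unit_ballP[_ f1] x; have [_] := CP x; apply.
Qed.

End Dual.

(** * Iterated Szlenk derivations *)

Section Iterates.
Context {R : realType} {K : numFieldType} {e : R -> K} {re : K -> R} {j : K}.
Hypothesis He : scalar_parts e re j.

(** Pulling neighborhoods back along [phi] gives a transfer principle. Taken at the identity it
    yields monotonicity in the set and, for iterates, in [eps]; taken at a rescaled translation it
    yields submultiplicativity. *)
Lemma szlenk_derivation_map (X Y : normedModType K) (eps eps' : R)
    (A : set (X -> K)) (B : set (Y -> K))
    (phi : {ptws X -> K} -> {ptws Y -> K}) :
  continuous phi -> (forall f, A f -> B (phi f)) ->
  (forall f g x, `|x| <= 1 -> e eps < `|f x - g x| ->
    exists2 y, `|y| <= 1 & e eps' < `|phi f y - phi g y|) ->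
  forall f, szlenk_derivation e eps A f -> szlenk_derivation e eps' B (phi f).
Proof.
move=> cphi AB far f /(szlenk_derivationP He)[Af H].
apply/(szlenk_derivationP He); split; first exact: AB.
move=> U /cphi /H [g [h [x [[Ag Ug] [Ah Uh] x1 gh]]]].
have [y y1 pgh] := far g h x x1 gh.
by exists (phi g), (phi h), y; split => //; split => //; exact: AB.
Qed.

Lemma szlenk_iter_map (X Y : normedModType K) (eps eps' : R)
    (A : set (X -> K)) (B : set (Y -> K))
    (phi : {ptws X -> K} -> {ptws Y -> K}) n :
  continuous phi -> (forall f, A f -> B (phi f)) ->
  (forall f g x, `|x| <= 1 -> e eps < `|f x - g x| ->
    exists2 y, `|y| <= 1 & e eps' < `|phi f y - phi g y|) ->
  forall f, szlenk_iter e eps A (ord_of_nat n) f ->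
    szlenk_iter e eps' B (ord_of_nat n) (phi f).
Proof.
move=> cphi AB far; elim: n => [|n IHn]; first exact: AB.
exact: szlenk_derivation_map.
Qed.

Variable X : normedModType K.
Implicit Types (eps del : R) (A B : set (X -> K)) (a b : ord).
Local Notation szI eps A n := (szlenk_iter e eps A (ord_of_nat n)).
Local Notation ball := (@dual_unit_ball R K e X).

Lemma szlenk_derivation_mono eps A B : A `<=` B ->
  szlenk_derivation e eps A `<=` szlenk_derivation e eps B.
Proof.
move=> AB; apply: (@szlenk_derivation_map X X eps eps A B id) => //.
  by move=> f U.
by move=> f g x x1 fg; exists x.
Qed.

Lemma szlenk_iter_mono eps A B n : A `<=` B -> szI eps A n `<=` szI eps B n.
Proof.
move=> AB; apply: (@szlenk_iter_map X X eps eps A B id) => //.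
  by move=> f U.
by move=> f g x x1 fg; exists x.
Qed.

Lemma szlenk_iter_le eps eps' A n :
  eps' <= eps -> szI eps A n `<=` szI eps' A n.
Proof.
move=> le_eps; apply: (@szlenk_iter_map X X eps eps' A A id) => //.
  by move=> f U.
move=> f g x x1 fg; exists x => //; apply: le_lt_trans fg.
by rewrite (sp_le He).
Qed.

Lemma szlenk_iter_sub eps A a : szlenk_iter e eps A a `<=` A.
Proof. by elim: a => [|a IHa|I F _] //= f [] // /IHa. Qed.

(** In particular, trees denoting the same ordinal give the same iterate. *)
Lemma szlenk_iter_anti eps A a b : ole a b ->
  szlenk_iter e eps A b `<=` szlenk_iter e eps A a.
Proof.
elim: a b => [|a IHa|I F IHF] b /=; first by move=> _; exact: szlenk_iter_sub.
- elim: b => [//|b _|J G IHG].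
    by move=> ab; exact: szlenk_derivation_mono (IHa _ ab).
  by move=> [i ai] f [_ /(_ i)]; exact: IHG.
- move=> Fb f bf; split; first exact: szlenk_iter_sub bf.
  by move=> i; exact: IHF (Fb i) _ bf.
Qed.

Lemma szlenk_iter_add eps A m n : szI eps A (m + n) = szI eps (szI eps A n) m.
Proof. by elim: m => //= m <-. Qed.

(** The derivation is local: a test neighborhood [V] of a point of [U] can be replaced by its
    intersection with [U]. *)
Lemma szlenk_iter_local eps A (U : set {ptws X -> K}) n : open U ->
  szI eps A n `&` U `<=` szI eps (A `&` U) n.
Proof.
move=> oU; elim: n => [//|n IHn] f [/(szlenk_derivationP He)[nf H] Uf].
apply: (szlenk_derivation_mono IHn); apply/(szlenk_derivationP He).
split => // V Vf.
have [|g [h [x [[Ag [Vg Ug]] [Ah [Vh Uh]] x1 gh]]]] := H (V `&` U).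
  by apply: filterI => //; exact: open_nbhs_nbhs.
by exists g, h, x.
Qed.

Lemma closed_szlenk_iter eps n : closed (szI eps ball n : set {ptws X -> K}).
Proof.
elim: n => [|n IHn]; last exact: (closed_szlenk_derivation He).
apply: compact_closed; last exact: (compact_dual_unit_ball He).
apply: (@hausdorff_product X (fun=> K)) => _; exact: norm_hausdorff.
Qed.

Lemma compact_szlenk_iter eps n : compact (szI eps ball n : set {ptws X -> K}).
Proof.
apply: (subclosed_compact (@closed_szlenk_iter _ _)).
  exact: (compact_dual_unit_ball He).
exact: szlenk_iter_sub.
Qed.

(** If no finite iterate vanished, these decreasing closed subsets of a compact set would have a
    common point, which would lie in the iterate at [omega]. *)
Lemma szlenk_iter_omega eps : szlenk_iter e eps ball omega = set0 ->
  exists n, szI eps ball n = set0.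
Proof.
move=> H0; apply: contrapT => /forallNP ne.
pose P n : set {ptws X -> K} := szI eps ball n.
pose F := filter_from [set: nat] P.
have FF : ProperFilter F.
  apply: filter_from_proper; last first.
    by move=> n _; apply/set0P/eqP; exact: ne.
  apply: filter_from_filter; first by exists 0%N.
  move=> m n _ _; exists (maxn m n) => //.
  by rewrite subsetI; split; apply: szlenk_iter_anti; apply/ole_nat;
    rewrite ?leq_maxl ?leq_maxr.
have [|f [Bf cf]] := @compact_dual_unit_ball _ _ _ _ _ He X F FF.
  by exists 0%N.
suff : szlenk_iter e eps ball omega f by rewrite H0.
split => // n; apply: (@closed_szlenk_iter eps n) => U Uf.
by apply: cf => //; exists n.
Qed.

(** By totality, a tree [b] not above [n] is at most the predecessor of [n], whose iterate would
    then be empty as well. *)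
Lemma szlenk_at_nat eps n : szI eps ball n = set0 ->
  (forall m, (m < n)%N -> szI eps ball m <> set0) ->
  is_szlenk_at e X eps (ord_of_nat n).
Proof.
move=> n0 nmin; split=> // b b0; case: n n0 nmin => [//|n] n0 nmin.
case: (ole_total (ord_of_nat n) b) => // bn; case: (nmin n) => //.
by rewrite -subset0 -b0; exact: szlenk_iter_anti.
Qed.

Lemma szlenk_natP eps : (exists n, szI eps ball n = set0) ->
  is_szlenk_at e X eps (ord_of_nat (szlenk_nat e X eps)).
Proof.
move=> ex; have exb : exists n, `[< szI eps ball n = set0 >].
  by have [n n0] := ex; exists n; exact/asboolP.
apply: (@xgetPex _ 0%N [set n | is_szlenk_at e X eps (ord_of_nat n)]).
case: (ex_minnP exb) => n /asboolP n0 nmin; exists n.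
apply: szlenk_at_nat => // m mn m0.
by have := nmin m (asboolT m0); rewrite leqNgt mn.
Qed.

Lemma szlenk_nat_le eps n : szI eps ball n = set0 ->
  (szlenk_nat e X eps <= n)%N.
Proof.
by move=> n0; apply/ole_nat; apply: (szlenk_natP _).2 => //; exists n.
Qed.

Lemma szlenk_nat0 eps n : szI eps ball n = set0 ->
  szI eps ball (szlenk_nat e X eps) = set0.
Proof. by move=> n0; apply: (szlenk_natP _).1; exists n. Qed.

(** The ball contains the zero functional, so the index cannot be zero. Positivity is needed to take
    logarithms. *)
Lemma szlenk_nat_gt0 eps n : szI eps ball n = set0 ->
  (0 < szlenk_nat e X eps)%N.
Proof.
move=> /szlenk_nat0; rewrite lt0n; apply: contraPneq => -> /=.
rewrite -subset0 => /(_ (fun=> 0)); apply.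
apply/(dual_unit_ballP He); split; first by move=> k x y; rewrite mulr0 addr0.
by move=> x; rewrite normr0.
Qed.

(** Near a point [f] removed by the [del]-derivation, the set lies in
    [f + del * ball], and [m] derivations with [eps * del] leave nothing of
    this translate. *)
Lemma szlenk_mul eps del m n : 0 < eps -> 0 < del ->
  szI eps ball m = set0 -> szI del ball n = set0 ->
  szI (eps * del) ball (m * n) = set0.
Proof.
move=> eps0 del0 m0 n0.
(* Each block of [m] derivations with [eps * del] removes at least what one derivation with [del]
   removes. *)
suff sub k : szI (eps * del) ball (m * k) `<=` szI del ball k.
  by rewrite -subset0 -n0; exact: sub.
elim: k => [|k IHk]; first by rewrite muln0.
rewrite mulnS szlenk_iter_add => f /(szlenk_iter_mono IHk) fm.
have Af := szlenk_iter_sub fm.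
apply: contrapT => nf; have [U [oU Uf] HU] : exists2 U : set {ptws X -> K},
    open U /\ U f & forall g h x, (szI del ball k `&` U) g ->
      (szI del ball k `&` U) h -> `|x| <= 1 -> `|g x - h x| <= e del.
  apply: contrapT => nU; apply: nf; split => // U oU Uf.
  rewrite ltNge; apply/negP => dU; apply: nU; exists U => // g h x Ag Ah x1.
  rewrite real_leNgt ?normr_real//; last by rewrite ger0_real// (sp_ge0 He) ltW.
  apply/negP => gh; move: dU; rewrite leNgt => /negP; apply.
  apply/ereal_sup_gtP; exists (dual_norm e (g \- h)).
    by exists g => //; exists h.
  by apply/(lt_dual_normP He); exists x.
(* This map sends the points of the [k]-th iterate in [U] into the unit ball and turns separation
   [eps * del] into separation [eps]. *)
pose phi (g : {ptws X -> K}) : {ptws X -> K} :=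
  fun x => (e del)^-1 * (g x - f x).
have ed0 : 0 < e del by rewrite (sp_gt0 He).
have phiB g h x : `|phi g x - phi h x| = (e del)^-1 * `|g x - h x|.
  rewrite /phi -mulrBr opprB addrA subrK normrM gtr0_norm// invr_gt0//.
suff : szI eps ball m (phi f) by rewrite m0.
apply: (@szlenk_iter_map X X (eps * del) eps (szI del ball k `&` U)).
- move=> g V /ptws_nbhsP[s [d [d0 sub]]].
  apply/ptws_nbhsP; exists s, (e del * d); split; first by rewrite mulr_gt0.
  move=> h hg; apply: sub => x /hg.
  by rewrite phiB ltr_pdivrMl.
- have ball_scalar g : szI del ball k g -> scalar g.
    by move=> /szlenk_iter_sub[].
  move=> g [Ag Ug]; split.
    move=> l x y; rewrite /phi (ball_scalar _ Ag) (ball_scalar _ Af); ring.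
  rewrite leNgt; apply/negP => /(lt_dual_normP He)[x x1].
  rewrite (sp_e1 He) => /lt_geF/negP; apply.
  have := HU g f x (conj Ag Ug) (conj Af Uf) x1.
  by rewrite normrM gtr0_norm ?invr_gt0// ler_pdivrMl// mulr1.
- move=> g h x x1; rewrite (sp_eM He) => gh; exists x => //.
  by rewrite phiB ltr_pdivlMl// mulrC.
- by apply: szlenk_iter_local => //; split.
Qed.

(** In the induction step, points of the previous iterate near [f] are lifted, and [F] is a weak*
    cluster point of these lifts. The lifts are kept away from [f] itself, not merely from each
    other, which costs the factor 2. *)
Lemma szlenk_subspace_lift (S : submodClosed X) eps n
    (f : normed_subspace S -> K) :
  szlenk_iter e eps (@dual_unit_ball R K e (normed_subspace S)) (ord_of_nat n)
    f ->
  exists2 F, szI (eps / 2) ball n F & forall u, F (val u) = f u.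
Proof.
elim: n f => [f|n IHn f fn].
  move=> /(dual_unit_ballP He)[sf f1].
  have [F [sF F1 Ff]] := hahn_banach He sf f1.
  by exists F => //; apply/(dual_unit_ballP He).
pose res (G : {ptws X -> K}) : {ptws (normed_subspace S) -> K} :=
  fun u => G (val u).
pose P (W : set {ptws (normed_subspace S) -> K}) : set {ptws X -> K} :=
  fun G => [/\ szI (eps / 2) ball n G, W (res G) &
    exists2 u : normed_subspace S,
      `|u| <= 1 & e (eps / 2) < `|G (val u) - f u|].
pose Fl := filter_from (nbhs (f : {ptws (normed_subspace S) -> K})) P.
have FF : ProperFilter Fl.
  apply: filter_from_proper; last first.
    move=> W /(szlenk_derivation_half He fn)[g [u [/IHn[G Gn Gg] Wg u1 gf]]].
    exists G; split => //; last by exists u; rewrite ?Gg.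
    by have -> : res G = g by apply/funext.
  apply: filter_from_filter; first by exists setT; exact: filterT.
  move=> V W Vf Wf; exists (V `&` W); first exact: filterI.
  by move=> G [Gn [VG WG] far].
have [|F [Fn cF]] := @compact_szlenk_iter (eps / 2) n Fl FF.
  by exists setT; [exact: filterT|move=> G []].
(* The restrictions of the lifts converge to [f] pointwise, so a cluster point of the lifts must
   restrict to [f]. *)
have Ff u : F (val u) = f u.
  apply/eqP/negPn/negP; rewrite -subr_eq0 -normr_gt0 => Ff0.
  pose d := `|F (val u) - f u| / 2.
  have d0 : 0 < d by rewrite divr_gt0.
  have [||G [[_ /= Gf _] /= GF]] := cF
    (P [set g | `|g u - f u| < d]) [set G | `|G (val u) - F (val u)| < d].
  - exists [set g | `|g u - f u| < d] => //.
    apply/ptws_nbhsP; exists [:: u], d; split => // g; apply.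
    by rewrite mem_head.
  - apply/ptws_nbhsP; exists [:: val u], d; split => // g; apply.
    by rewrite mem_head.
  have : `|F (val u) - f u| < d + d.
    rewrite -(subrK (G (val u)) (F (val u))) -addrA.
    by apply: le_lt_trans (ler_normD _ _) _; rewrite ltrD// distrC.
  by rewrite /d -splitr ltxx.
(* The separation recorded in [P] is seen by a vector of the subspace, where [F] and [f] agree;
   hence it separates the lift from [F]. *)
exists F => //; apply: (szlenk_derivation_intro He) => // U UF.
have [|//|G [[Gn _ [u u1 Gf]] UG]] := cF (P setT) U.
  by exists setT => //; exact: filterT.
by exists G, (val u); rewrite Ff.
Qed.

Lemma szlenk_subspace (S : submodClosed X) eps n :
  szI (eps / 2) ball n = set0 ->
  szlenk_iter e eps (@dual_unit_ball R K e (normed_subspace S)) (ord_of_nat n)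
    = set0.
Proof.
by move=> n0; rewrite -subset0 => f /szlenk_subspace_lift[F]; rewrite n0.
Qed.

End Iterates.

(** * The separable subspace *)

(** Closing off under choice functions: [T] consists of the formal terms built from them, and [v]
    evaluates a term. Taking terms as the index set makes countability immediate. *)
Lemma countable_closure (I : countType) (Z : Type) (z0 : Z)
    (P : I -> seq Z -> Z -> Prop) :
  exists (T : countType) (v : T -> Z), forall i ts z,
    P i (map v ts) z -> exists t, P i (map v ts) (v t).
Proof.
(* Tree nodes are labelled by naturals, so an index [i] enters through its code; labels that decode
   to nothing, and unsatisfiable requests, return [z0]. *)
have op_ex (p : nat * seq Z) : exists z, forall i, unpickle p.1 = Some i ->
    (exists z', P i p.2 z') -> P i p.2 z.
  case: p => n s /=; case: (unpickle n) => [i|]; last by exists z0.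
  have [[z Pz]|nP] := pselect (exists z, P i s z).
    by exists z => _ [<-].
  by exists z0 => _ [<-].
have [op opP] := choice op_ex.
pose v := fix v (t : GenTree.tree unit) : Z :=
  match t with
  | GenTree.Leaf _ => z0
  | GenTree.Node n ts => op (n, map v ts)
  end.
exists (GenTree.tree unit), v => i ts z Pz.
exists (GenTree.Node (pickle i) ts).
exact: (opP (pickle i, map v ts) i (pickleK i) (ex_intro _ z Pz)).
Qed.

Lemma submodClosed_of_set (K : numFieldType) (X : normedModType K)
    (A : set X) : A 0 ->
  (forall k x y, A x -> A y -> A (k *: x + y)) ->
  exists S : submodClosed X, forall x, x \in S <-> A x.
Proof.
move=> A0 AL; pose P : {pred X} := fun x => `[< A x >].
have PL : submod_closed P.
  split=> [|k x y]; rewrite /P !unfold_in; first exact/asboolP.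
  by move=> /asboolP Ax /asboolP Ay; apply/asboolP; exact: AL.
pose S : submodClosed X := HB.pack P
  (GRing.isSubmodClosed.Build K X P (GRing.submod_closed_semi PL)).
by exists S => x; split=> /asboolP.
Qed.

Section Separable.
Context {R : realType} {K : numFieldType} {e : R -> K} {re : K -> R} {j : K}.
Hypothesis He : scalar_parts e re j.

Lemma norm_ltE (V : normedZmodType K) (x : V) r :
  (`|x| < e r) = (re `|x| < r).
Proof. by rewrite -{1}(sp_normE He) (sp_lt He). Qed.

Lemma re_normD (V : normedZmodType K) (x y : V) :
  re `|x + y| <= re `|x| + re `|y|.
Proof. by rewrite -(sp_le He) (sp_eD He) !(sp_normE He) ler_normD. Qed.

Lemma re_normM (X : normedModType K) k (x : X) :
  re `|k *: x| = re `|k| * re `|x|.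
Proof. by rewrite normrZ -{1}(sp_normE He k) (sp_reZ He). Qed.

Lemma rat_scalar_dense k (r : R) : 0 < r ->
  exists a b : rat, re `|k - (e (ratr a) - j * e (ratr b))| < r.
Proof.
move=> r0; have r20 : 0 < r / 2 by rewrite divr_gt0.
have dense (c : R) : exists a : rat, `|c - ratr a| < r / 2.
  have [|a] := @rat_in_itvoo R c (c + r / 2); first by rewrite ltrDl.
  rewrite in_itv /= => /andP[ca ac]; exists a.
  by rewrite ltr_norml; lra.
have [a ka] := dense (re k); have [b kb] := dense (re (j * k)).
exists a, b.
have -> : k - (e (ratr a) - j * e (ratr b)) =
    e (re k - ratr a) + - (j * e (re (j * k) - ratr b)).
  by rewrite {1}(sp_decomp He k) !(sp_eB He); ring.
apply: le_lt_trans (re_normD _ _) _; rewrite [r]splitr; apply: ltrD.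
  by rewrite -norm_ltE (sp_norm He) (sp_lt He).
rewrite normrN -norm_ltE normrM (sp_norm He).
apply: (@le_lt_trans _ _ (e `|re (j * k) - ratr b|)).
  by rewrite ler_piMl ?(sp_normj_le1 He)// (sp_ge0 He).
by rewrite (sp_lt He).
Qed.

Variable X : normedModType K.
Local Notation ball := (@dual_unit_ball R K e).

Lemma closure_normP (D : set X) x :
  closure D x <-> forall r, 0 < r -> exists2 y, D y & re `|x - y| < r.
Proof.
split=> [clx r r0|H U].
  have er0 : 0 < e r by rewrite (sp_gt0 He).
  have [y [Dy xy]] := clx _ (nbhsx_ballx x _ er0).
  by exists y => //; rewrite -norm_ltE; move: xy; rewrite -ball_normE.
move=> /nbhs_ballP[r /= r0 rU].
have [|y Dy xy] := H (re r); first by rewrite -(sp_gt0 He) (sp_ge0E He)// ltW.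
exists y; split=> //; apply: rU; rewrite -ball_normE /=.
by rewrite -(sp_ge0E He (ltW r0)) norm_ltE.
Qed.

Lemma separable_subspace : exists S : submodClosed X,
  [/\ closed [set x : X | x \in S], separable (normed_subspace S)
    & forall eps n, 0 < eps ->
      szlenk_iter e (eps / 4) (ball (X := normed_subspace S)) (ord_of_nat n)
        = set0 ->
      szlenk_iter e eps (ball (X := X)) (ord_of_nat n) = set0].
Proof.
pose szI eps n := szlenk_iter e eps (ball (X := X)) (ord_of_nat n).
pose Z := ((X -> K) * X)%type; pose z0 : Z := (fun=> 0, 0).
(* The clauses provide a point of each nonempty iterate, a point of an iterate
   weak*-near to the first member of [s] with a vector showing that the two are
   far apart in norm, and linear combinations. *)
pose P (i : (rat * nat) + (rat * nat * rat) + (rat * rat))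
    (s : seq Z) (z : Z) :=
  match i with
  | inl (inl (q, n)) => szI (ratr q) n z.1
  | inl (inr (q, n, r)) =>
      [/\ szI (ratr q) n z.1,
        (forall w, w \in map snd s ->
          `|z.1 w - (nth z0 s 0).1 w| < e (ratr r)),
        `|z.2| <= 1 & e (ratr q / 2) < `|z.1 z.2 - (nth z0 s 0).1 z.2|]
  | inr (a, b) => z.2 =
      (e (ratr a) - j * e (ratr b)) *: (nth z0 s 0).2 + (nth z0 s 1).2
  end.
have [T [v vP]] := countable_closure z0 P.
pose D := range (fun t => (v t).2).
have D_lin a b t u : exists t', (v t').2 =
    (e (ratr a) - j * e (ratr b)) *: (v t).2 + (v u).2.
  exact: (vP (inr (a, b)) [:: t; u] (z0.1, _) erefl).
have D0 : D 0.
  (* On the empty list both members default to [z0], so the clause for linear combinations produces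
     the zero vector. *)
  have P0 : P (inr (0, 0)) (map v [::]) z0 by rewrite /= scaler0 addr0.
  have [t t0] := vP _ [::] _ P0.
  by exists t => //; rewrite [LHS]t0 /= scaler0 addr0.
have [S SP] : exists S : submodClosed X, forall x, x \in S <-> closure D x.
  apply: submodClosed_of_set; first exact: subset_closure.
  move=> k x y /closure_normP Dx /closure_normP Dy; apply/closure_normP => r r0.
  (* The three errors come from approximating [x], then the scalar [k], then [y]. Adding 1 to the
     norms keeps the divisors positive. *)
  have r30 : 0 < r / 3 by rewrite divr_gt0.
  have k1 : 0 < re `|k| + 1 by rewrite ltr_wpDl// (sp_norm_ge0 He).
  have [_ [t _ <-] xt] := Dx (r / 3 / (re `|k| + 1)) (divr_gt0 r30 k1).
  have [_ [u _ <-] yu] := Dy _ r30.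
  have t1 : 0 < re `|(v t).2| + 1 by rewrite ltr_wpDl// (sp_norm_ge0 He).
  have [a [b kab]] := rat_scalar_dense k (divr_gt0 r30 t1).
  set l := e (ratr a) - j * e (ratr b) in kab.
  have [t' t'E] := D_lin a b t u.
  exists (v t').2; first by exists t'.
  rewrite t'E.
  have -> : k *: x + y - (l *: (v t).2 + (v u).2) =
      (k *: (x - (v t).2) + (k - l) *: (v t).2) + (y - (v u).2).
    rewrite opprD addrACA; congr (_ + _).
    by rewrite scalerBr [(k - l) *: _]scalerBl addrA subrK.
  apply: le_lt_trans (re_normD _ _) _.
  have -> : r = (r / 3 + r / 3) + r / 3 by field.
  apply: ltrD yu; apply: le_lt_trans (re_normD _ _) _.
  rewrite !re_normM; apply: ltrD.
    rewrite ltr_pdivlMr// in xt; apply: le_lt_trans xt.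
    by rewrite mulrC ler_wpM2l ?(sp_norm_ge0 He)// lerDl.
  rewrite ltr_pdivlMr// in kab; apply: le_lt_trans kab.
  by rewrite ler_wpM2l ?(sp_norm_ge0 He)// lerDl.
have inS t : (v t).2 \in S.
  by apply/SP; apply: subset_closure; exists t.
pose w t : normed_subspace S := exist _ (v t).2 (inS t).
exists S; split.
- have -> : [set x : X | x \in S] = closure D by apply/seteqP; split=> x /SP.
  exact: closed_closure.
- exists (range w); split.
    exact: sub_countable (card_image_le _ _) (countableP _).
  move=> O [u Ou] oO; have /nbhs_ballP[r /= r0 rO] : nbhs u O.
    exact: open_nbhs_nbhs.
  have /SP/closure_normP := valP u.
  move=> /(_ (re r)) []; first by rewrite -(sp_gt0 He) (sp_ge0E He)// ltW.
  move=> _ [t _ <-] ut; exists (w t); split; last by exists t.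
  apply: rO; rewrite -ball_normE /=.
  have -> : `|u - w t| = `|val u - (v t).2| by [].
  by rewrite -(sp_ge0E He (ltW r0)) norm_ltE.
move=> eps n eps0 n0.
(* With [q] below [eps], the iterates for [eps] lie in those for [q]; with [q / 2] above [eps / 4],
   the iterates on the subspace obtained for [q / 2] lie in the vanishing one. *)
have [|q] := @rat_in_itvoo R (eps / 2) eps; first by lra.
rewrite in_itv /= => /andP[epsq qeps].
pose res (f : X -> K) : normed_subspace S -> K := fun u => f (val u).
have ind m t : szI (ratr q) m (v t).1 ->
    szlenk_iter e (ratr q / 2) (ball (X := normed_subspace S)) (ord_of_nat m)
      (res (v t).1).
  elim: m t => [t /(dual_unit_ballP He)[sf f1]|m IHm t tm].
    apply/(dual_unit_ballP He); split=> [k x y|x]; last exact: f1.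
    by rewrite /res linearP sf.
  have tball : ball (v t).1 by exact: szlenk_iter_sub tm.
  apply: (szlenk_derivation_intro He).
    by apply: IHm; case/(szlenk_derivationP He): tm.
  move=> U /ptws_nbhsP[s [d [d0 dU]]].
  have rd0 : 0 < re d by rewrite -(sp_gt0 He) (sp_ge0E He)// ltW.
  have rd40 : 0 < re d / 4 by rewrite divr_gt0.
  (* A neighborhood on the subspace tests arbitrary vectors [u]. Replacing each by a chosen vector
     costs [re d / 4] for each of the two functionals, as both are 1-Lipschitz, and less than
     [re d / 4] remains for their difference there. *)
  have near_ex (u : normed_subspace S) :
      exists t', re `|val u - (v t').2| < re d / 4.
    have /SP/closure_normP /(_ _ rd40) := valP u.
    by move=> [_ [t' _ <-]]; exists t'.
  have [tau tauP] := choice near_ex.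
  have [r] := rat_in_itvoo rd40; rewrite in_itv /= => /andP[r0 rd].
  (* The head supplies the functional to be approximated, the tail the vectors describing the
     neighborhood. *)
  pose ts := t :: map tau s.
  have [|g [x [gm gnear x1 gx]]] :=
      szlenk_derivation_half He (U := [set g | forall y,
        y \in map snd (map v ts) -> `|g y - (v t).1 y| < e (ratr r)]) tm.
    apply/ptws_nbhsP; exists (map snd (map v ts)), (e (ratr r)).
    by split; rewrite ?(sp_gt0 He).
  have [t' [t'm t'near t'1 t'x]] :=
    vP (inl (inr (q, m, r))) ts (g, x) (And4 gm gnear x1 gx).
  have t'ball : ball (v t').1 by exact: szlenk_iter_sub t'm.
  exists (res (v t').1), (w t'); split=> //; first exact: IHm.
  apply: dU => u us.
  have {}t'near : re `|(v t').1 (v (tau u)).2 - (v t).1 (v (tau u)).2| < ratr r.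
    rewrite -norm_ltE; apply: t'near; rewrite /= in_cons; apply/orP; right.
    by rewrite -!map_comp; apply/mapP; exists u.
  have lip (f : X -> K) : ball f ->
      re `|f (val u) - f (v (tau u)).2| < re d / 4.
    move=> /(dual_unit_ballP He)[sf f1]; apply: le_lt_trans (tauP u).
    rewrite -(sp_le He) !(sp_normE He).
    have -> : f (val u) - f (v (tau u)).2 = f (val u - (v (tau u)).2).
      by rewrite [val u - _]addrC -(scaleN1r (v (tau u)).2) sf mulN1r addrC.
    exact: f1.
  rewrite -(sp_ge0E He (ltW d0)) norm_ltE.
  have -> : res (v t').1 u - res (v t).1 u =
     ((v t').1 (val u) - (v t').1 (v (tau u)).2) +
     (((v t').1 (v (tau u)).2 - (v t).1 (v (tau u)).2) +
      - ((v t).1 (val u) - (v t).1 (v (tau u)).2)).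
    by rewrite /res; ring.
  apply: le_lt_trans (re_normD _ _) _.
  have := re_normD ((v t').1 (v (tau u)).2 - (v t).1 (v (tau u)).2)
    (- ((v t).1 (val u) - (v t).1 (v (tau u)).2)).
  rewrite normrN; have := lip _ tball; have := lip _ t'ball; lra.
rewrite -subset0 => f fn.
(* The functional [f] need not be a chosen one, but its presence makes the iterate for [q] nonempty,
   so that a chosen one lies there. *)
have [|t tn] := vP (inl (inl (q, n))) [::] (f, 0).
  by apply: (szlenk_iter_le He) fn; exact: ltW.
suff : (set0 : set (normed_subspace S -> K)) (res (v t).1) by [].
rewrite -n0; apply: (szlenk_iter_le He) (ind _ _ tn); lra.
Qed.

End Separable.

(** * Power types *)

Section PowerType.
Context {R : realType}.
Implicit Types (N M : R -> nat) (C p eps del : R).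

(** The threshold [expR (- (C / eta))] comes from solving the last inequality. This is how bounded
    errors in the logarithm disappear in the limit. *)
Lemma small_over_ln C (eta : R) : 0 < eta ->
  \forall eps \near 0^'+, [/\ 0 < eps, eps < 1, 0 < `|ln eps|
    & C / `|ln eps| < eta].
Proof.
move=> eta0; near=> eps.
have eps0 : 0 < eps by near: eps; exact: nbhs_right_gt.
have eps1 : eps < 1 by near: eps; exact: nbhs_right_lt.
have epsC : eps < expR (- (C / eta)).
  by near: eps; apply: nbhs_right_lt; exact: expR_gt0.
have ln0 : ln eps < 0 by apply: ln_lt0; rewrite eps0.
have lnC : ln eps < - (C / eta).
  by rewrite -[ltRHS]expRK ltr_ln// posrE expR_gt0.
split => //; first by rewrite normr_gt0 lt_eqF.
rewrite ltr0_norm// ltr_pdivrMr ?oppr_gt0// mulrC -ltr_pdivrMr//.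
by rewrite ltrNr.
Unshelve. all: by end_near. Qed.

(** At zero the logarithm takes the default value 0. *)
Lemma ln_nat_ge0 (n : nat) : (0 : R) <= ln n%:R.
Proof. by case: n => [|n]; [rewrite ln0|rewrite ln_ge0// ler1n]. Qed.

Lemma ln_nat_le (m n : nat) : (0 < m)%N -> (m <= n)%N ->
  ln (m%:R : R) <= ln n%:R.
Proof.
move=> m0 mn; have n0 := leq_trans m0 mn.
by rewrite ler_ln ?posrE ?ltr0n// ler_nat.
Qed.

Lemma ln_natM (m n : nat) : (0 < m)%N -> (0 < n)%N ->
  ln ((m * n)%:R : R) = ln m%:R + ln n%:R.
Proof. by move=> m0 n0; rewrite natrM lnM// posrE ltr0n. Qed.

(** Fekete's argument: the limit is the infimum of the quotients over [0 < del < 1]. A nearly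
    optimal [del] controls every small [eps] through its powers. *)
Lemma submultiplicative_power_type N :
  (forall eps, 0 < eps -> (0 < N eps)%N) ->
  (forall eps del, 0 < eps -> eps <= del -> (N del <= N eps)%N) ->
  (forall eps del, 0 < eps -> 0 < del ->
    (N (eps * del)%R <= N eps * N del)%N) ->
  exists p : R, ln (N eps)%:R / `|ln eps| @[eps --> 0^'+] --> p.
Proof.
move=> N0 Nmono Nmul.
pose L eps : R := ln (N eps)%:R.
pose E := [set L del / `|ln del| | del in [set del : R | 0 < del < 1]].
have Elb : lbound E 0.
  by move=> _ [del _ <-]; rewrite divr_ge0// ln_nat_ge0.
have E0 : E !=set0.
  by exists (L 2^-1 / `|ln 2^-1|); exists 2^-1 => //=; lra.
have Einf : has_inf E by split => //; exists 0.
exists (inf E); apply/cvgrPdist_lt => eta eta0.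
have eta20 : 0 < eta / 2 by rewrite divr_gt0.
have [_ [del /andP[del0 del1] <-] Ldel] := inf_adherent eta20 Einf.
near=> eps.
have [eps0 eps1 lneps0 epsC] : [/\ 0 < eps, eps < 1, 0 < `|ln eps|
    & L del / `|ln eps| < eta / 2].
  by near: eps; exact: small_over_ln.
have infle : inf E <= L eps / `|ln eps|.
  by apply: ge_inf; [exists 0|exists eps; rewrite //= eps0].
rewrite ltr_norml; apply/andP; split; last first.
  by apply: le_lt_trans eta0; rewrite subr_le0.
suff : L eps / `|ln eps| <= L del / `|ln del| + L del / `|ln eps|.
  by move: Ldel epsC; rewrite /L; lra.
have lndel0 : 0 < `|ln del| by rewrite normr_gt0 lt_eqF// ln_lt0// del0.
(* By this choice [del ^+ k.+1 <= eps], so [L eps <= k.+1%:R * L del]; the extra factor from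
   rounding up contributes only [L del / |ln eps|]. *)
pose k := Num.truncn (`|ln eps| / `|ln del|).
have /andP[kle klt] : k%:R <= `|ln eps| / `|ln del| < k.+1%:R.
  by apply: truncn_itv; rewrite divr_ge0.
have powle : del ^+ k.+1 <= eps.
  rewrite -ler_ln ?posrE ?exprn_gt0// lnXn//.
  move: klt; rewrite ltr_pdivrMr// => klt.
  rewrite -lerN2 -mulNrn -[- ln del]ltr0_norm ?ln_lt0 ?del0//.
  by rewrite -[- ln eps]ltr0_norm ?ln_lt0 ?eps0// -mulr_natl ltW.
have Npow n : L (del ^+ n.+1) <= n.+1%:R * L del.
  elim: n => [|n IHn]; first by rewrite expr1 mul1r.
  have d0 : 0 < del ^+ n.+1 by rewrite exprn_gt0.
  rewrite exprS -[n.+2]addn1 natrD mulrDl mul1r.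
  apply: le_trans (ln_nat_le _ (Nmul _ _ del0 d0)) _.
    by apply: N0; rewrite mulr_gt0.
  by rewrite ln_natM ?N0// addrC lerD2r.
have Leps : L eps <= k.+1%:R * L del.
  apply: le_trans (Npow k); apply: ln_nat_le; first exact: N0.
  by apply: Nmono => //; rewrite exprn_gt0.
rewrite ler_pdivrMr// mulrDl divfK ?gt_eqF//.
apply: le_trans Leps _; rewrite -natr1 mulrDl mul1r lerD2r.
by rewrite mulrAC -mulrA [leRHS]mulrC ler_wpM2r// ln_nat_ge0.
Unshelve. all: by end_near. Qed.

(** The two logarithms differ by at most [ln c%:R], which is negligible against [|ln eps|]. *)
Lemma power_type_equiv N M (c : nat) p :
  (forall eps, 0 < eps -> (0 < N eps)%N) ->
  (forall eps, 0 < eps -> (0 < M eps)%N) ->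
  (forall eps, 0 < eps -> (M eps <= c * N eps)%N) ->
  (forall eps, 0 < eps -> (N eps <= c * M eps)%N) ->
  ln (N eps)%:R / `|ln eps| @[eps --> 0^'+] --> p ->
  ln (M eps)%:R / `|ln eps| @[eps --> 0^'+] --> p.
Proof.
move=> N0 M0 MN NM /cvgrPdist_lt Np; apply/cvgrPdist_lt => eta eta0.
have eta20 : 0 < eta / 2 by rewrite divr_gt0.
have c0 : (0 < c)%N.
  have := leq_trans (M0 1 ltr01) (MN 1 ltr01).
  by rewrite muln_gt0 => /andP[].
near=> eps.
have [eps0 eps1 ln0 epsC] : [/\ 0 < eps, eps < 1, 0 < `|ln eps|
    & ln c%:R / `|ln eps| < eta / 2].
  by near: eps; exact: small_over_ln.
have : `|p - ln (N eps)%:R / `|ln eps| | < eta / 2.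
  by near: eps; exact: Np.
have MN' : ln ((M eps)%:R : R) <= ln c%:R + ln (N eps)%:R.
  by rewrite -ln_natM ?N0//; apply: ln_nat_le; [exact: M0|exact: MN].
have NM' : ln ((N eps)%:R : R) <= ln c%:R + ln (M eps)%:R.
  by rewrite -ln_natM ?M0//; apply: ln_nat_le; [exact: N0|exact: NM].
have MN2 : ln (M eps)%:R / `|ln eps| <=
    ln c%:R / `|ln eps| + ln (N eps)%:R / `|ln eps|.
  by rewrite -mulrDl ler_wpM2r// invr_ge0.
have NM2 : ln (N eps)%:R / `|ln eps| <=
    ln c%:R / `|ln eps| + ln (M eps)%:R / `|ln eps|.
  by rewrite -mulrDl ler_wpM2r// invr_ge0.
rewrite !ltr_norml => /andP[h1 h2]; apply/andP; split; lra.
Unshelve. all: by end_near. Qed.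

End PowerType.

(** * Finite Szlenk indices as a function of [eps] *)

Section SzlenkNat.
Context {R : realType} {K : numFieldType} {e : R -> K} {re : K -> R} {j : K}.
Hypothesis He : scalar_parts e re j.
Variable X : normedModType K.
Implicit Types eps del : R.
Local Notation vanishes eps n :=
  (szlenk_iter e eps (@dual_unit_ball R K e X) (ord_of_nat n) = set0).
Local Notation N := (szlenk_nat e X).

Lemma is_szlenk_omega_finite : is_szlenk e X omega ->
  forall eps, 0 < eps -> exists n, vanishes eps n.
Proof.
move=> [ex le_omega _] eps eps0; have [b bE] := ex _ eps0.
apply: (szlenk_iter_omega He); rewrite -subset0 -bE.1.
exact: (szlenk_iter_anti He) (le_omega _ _ eps0 bE).
Qed.

Hypothesis finite : forall eps, 0 < eps -> exists n, vanishes eps n.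

(** The supremum over all positive [eps] is itself a tree, as [OSup] accepts any index type. *)
Lemma finite_is_szlenk : exists2 a, is_szlenk e X a & ole a omega.
Proof.
have at_nat eps : 0 < eps -> is_szlenk_at e X eps (ord_of_nat (N eps)).
  by move=> eps0; apply: (szlenk_natP He); exact: finite.
exists (OSup (fun eps : {eps : R | 0 < eps} => ord_of_nat (N (sval eps)))).
  split=> [eps eps0|eps b eps0 bE|c cE].
  - by exists (ord_of_nat (N eps)); exact: at_nat.
  - apply: (@ole_sup _ _ _ (exist _ eps eps0)); apply: bE.2.
    exact: (at_nat _ eps0).1.
  - by move=> [eps eps0]; apply: cE (at_nat _ eps0).
by move=> [eps eps0]; apply: (@ole_sup _ _ _ (N eps)); exact/ole_nat.
Qed.

Lemma finite_gt0 eps : 0 < eps -> (0 < N eps)%N.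
Proof. by move=> /finite[n]; exact: (szlenk_nat_gt0 He). Qed.

Lemma finite_vanishes eps : 0 < eps -> vanishes eps (N eps).
Proof. by move=> /finite[n]; exact: (szlenk_nat0 He). Qed.

Lemma finite_mono eps del : 0 < eps -> eps <= del -> (N del <= N eps)%N.
Proof.
move=> eps0 le_eps; apply: (szlenk_nat_le He).
by rewrite -subset0 -(finite_vanishes eps0); exact: (szlenk_iter_le He).
Qed.

Lemma finite_submul eps del : 0 < eps -> 0 < del ->
  (N (eps * del)%R <= N eps * N del)%N.
Proof.
move=> eps0 del0; apply: (szlenk_nat_le He).
by apply: (szlenk_mul He) => //; exact: finite_vanishes.
Qed.

End SzlenkNat.

(** * Comparison of the power types of the space and the subspace *)

Unset Implicit Arguments.

Theorem proposition12 (R : realType) (K : numFieldType) (e : R -> K)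
    (He : scalar_field e) (X : completeNormedModType K)
    (HX : is_szlenk e X omega) :
  exists Y : submodClosed X,
    [/\ closed [set x : X | x \in Y],
        separable (normed_subspace Y)
      & exists p : R,
          is_szlenk_power_type e X p /\
          is_szlenk_power_type e (normed_subspace Y) p].
Proof.
have [re [j Hp]] := scalar_field_parts He.
have [Y [cY sY YX]] := separable_subspace Hp X.
exists Y; split => //.
have finX := is_szlenk_omega_finite Hp HX.
have finY (eps : R) : 0 < eps -> exists n, szlenk_iter e eps
    (@dual_unit_ball R K e (normed_subspace Y)) (ord_of_nat n) = set0.
  move=> eps0; have [|n n0] := finX (eps / 2); first by rewrite divr_gt0.
  by exists n; exact: (szlenk_subspace Hp).
pose N := szlenk_nat e X; pose M := szlenk_nat e (normed_subspace Y).
have half0 : 0 < 2^-1 :> R by rewrite invr_gt0.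
have quarter0 : 0 < 4^-1 :> R by rewrite invr_gt0.
have MN (eps : R) : 0 < eps -> (M eps <= N (eps * 2^-1)%R)%N.
  move=> eps0; apply: (szlenk_nat_le Hp); apply: (szlenk_subspace Hp).
  by apply: (finite_vanishes Hp finX); rewrite mulr_gt0.
have NM (eps : R) : 0 < eps -> (N eps <= M (eps / 4)%R)%N.
  move=> eps0; apply: (szlenk_nat_le Hp); apply: YX => //.
  by apply: (finite_vanishes Hp finY); rewrite divr_gt0.
have [p Xp] := submultiplicative_power_type (finite_gt0 Hp finX)
  (finite_mono Hp finX) (finite_submul Hp finX).
exists p; split; split; rewrite //; try exact: (finite_is_szlenk Hp).
(* Submultiplicativity absorbs the rescalings: [N (eps / 2)] is at most [N eps * N 2^-1], and
   [M (eps / 4)] at most [M eps * M 4^-1]. The maximum serves both bounds. *)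
apply: (@power_type_equiv _ N M (maxn (N 2^-1) (M 4^-1)) p) => //.
- exact: (finite_gt0 Hp finX).
- exact: (finite_gt0 Hp finY).
- move=> eps eps0; apply: leq_trans (MN _ eps0) _.
  apply: leq_trans (finite_submul Hp finX eps0 half0) _.
  by rewrite mulnC leq_mul2r leq_maxl orbT.
- move=> eps eps0; apply: leq_trans (NM _ eps0) _.
  apply: leq_trans (finite_submul Hp finY eps0 quarter0) _.
  by rewrite mulnC leq_mul2r leq_maxr orbT.
Qed.
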